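(* Let $l$ be a positive integer and $S=\mathbb{Z}_{2l}$ with the linear character $\chi([m])=e^{2\pi i m/(2l)}$. Define a linear map $\theta_A:\widehat{A}_S\to L(\mathfrak{gl}_l(\mathbb{C}))^{\bar\eta_1}$ by $$\theta_A(\mathbf{c})=0,\qquad \theta_A(A_{r,m})=a_{r,m}\otimes t^m\quad\text{for }r,m\in\mathbb{Z}.$$ Then $\theta_A$ is a Lie algebra epimorphism from $\widehat{A}_S$ onto $L(\mathfrak{gl}_l(\mathbb{C}))^{\bar\eta_1}$ with $$\ker\theta_A=\mathrm{span}\big(\{\mathbf{c}\}\cup\{A_{r+l,m}-(-1)^mA_{r,m}\mid r,m\in\mathbb{Z}\}\big).$$ Furthermore, $L(\mathfrak{gl}_l(\mathbb{C}))^{\bar\eta_1}\cong L(\mathfrak{gl}_l(\mathbb{C}))$ as Lie algebras.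
   Context: $\widehat{A}_S$ is the complex Lie algebra generated by $\mathbf{c}$ and $A_{\alpha,m}$ ($\alpha\in S$, $m\in\mathbb{Z}$) subject to the relations that $\mathbf{c}$ is central and $$[A_{\alpha,m},A_{\beta,n}]=(\chi(m\beta-n\alpha)-\chi(n\alpha-m\beta))A_{\alpha+\beta,m+n}+m\delta_{\alpha+\beta,0}\delta_{m+n,0}\mathbf{c};$$ these generators form a basis. For $r\in\mathbb{Z}$ write $A_{r,m}=A_{[r],m}$, and regard $\chi$ also as a homomorphism $\mathbb{Z}\to\mathbb{C}^\times$, $\chi(m)=e^{2\pi i m/(2l)}$. $L(\mathfrak g)=\mathfrak g\otimes\mathbb{C}[t,t^{-1}]$ is the loop algebra. Let $P,Q\in M(l,\mathbb{C})$ be $P=\sum_{j=1}^{l-1}E_{j,j+1}+E_{l,1}$ and $Q=\mathrm{diag}(\chi(2),\chi(4),\dots,\chi(2l))$, so $P^l=Q^l=I$, $PQ=\chi(2)QP$. For $r,m\in\mathbb{Z}$ set $a_{r,m}=\chi(rm)Q^rP^m\in M(l,\mathbb{C})$. Let $\eta_1(X)=Q^{-1}XQ$ for $X\in\mathfrak{gl}_l(\mathbb{C})$, and let $\bar\eta_1$ be the automorphism of $L(\mathfrak{gl}_l(\mathbb{C}))$ given by $\bar\eta_1(a\otimes t^m)=\chi(2)^{-m}(\eta_1(a)\otimes t^m)$. The superscript $\bar\eta_1$ denotes the fixed-point subalgebra. *)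

(* Defs.v *)
From HB Require Import structures.
From mathcomp Require Import all_boot all_order all_algebra finmap ring.
From mathcomp Require Import complex.
From mathcomp.multinomials Require Import monalg.
From mathcomp Require Import classical_sets reals trigo.

Set Implicit Arguments.
Unset Strict Implicit.
Unset Printing Implicit Defensive.

Import GRing.Theory Num.Theory.

Local Open Scope ring_scope.

HB.mixin Record Lmodule_isLieAlgebra (K : fieldType) L
    of GRing.Lmodule K L := {
  bracket : L -> L -> L;
  bracketPl : forall (a : K) (x y z : L),
    bracket (a *: x + y) z = a *: bracket x z + bracket y z;
  bracketPr : forall (a : K) (x y z : L),
    bracket x (a *: y + z) = a *: bracket x y + bracket x z;
  bracketxx : forall x : L, bracket x x = 0;
  bracket_jacobi : forall x y z : L,
    bracket x (bracket y z) + bracket y (bracket z x)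
    + bracket z (bracket x y) = 0
}.

#[short(type="lieAlgType")]
HB.structure Definition LieAlgebra (K : fieldType) :=
  { L of GRing.Lmodule K L & Lmodule_isLieAlgebra K L }.

Notation "[ 'Lie' x , y ]" := (bracket x y)
  (at level 0, x at level 99, format "[ 'Lie'  x ,  y ]") : ring_scope.

HB.mixin Record isLieMorphism (K : fieldType) (L M : lieAlgType K)
    (f : L -> M) := {
  lie_morphism_subproof : forall x y : L, f [Lie x, y] = [Lie f x, f y]
}.

HB.structure Definition LieMorphism (K : fieldType) (L M : lieAlgType K) :=
  { f of isLieMorphism K L M f & @GRing.Linear K L M *:%R f }.

Notation "{ 'lie' L -> M }" := (LieMorphism.type L M)
  (at level 0, L at level 98, M at level 99, format "{ 'lie'  L  ->  M }")
  : type_scope.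

Section Bilinear.
Variables (K : fieldType) (V : lmodType K) (B : V -> V -> V).
Hypothesis BPl : forall a x y z, B (a *: x + y) z = a *: B x z + B y z.
Hypothesis BPr : forall a x y z, B x (a *: y + z) = a *: B x y + B x z.

Lemma bilDl x y z : B (x + y) z = B x z + B y z.
Proof. by have := BPl 1 x y z; rewrite !scale1r. Qed.

Lemma bilDr x y z : B x (y + z) = B x y + B x z.
Proof. by have := BPr 1 x y z; rewrite !scale1r. Qed.

Lemma bil0x x : B 0 x = 0.
Proof. by apply: (addrI (B 0 x)); rewrite -bilDl !addr0. Qed.

Lemma bilx0 x : B x 0 = 0.
Proof. by apply: (addrI (B x 0)); rewrite -bilDr !addr0. Qed.

Lemma bilZl a x y : B (a *: x) y = a *: B x y.
Proof. by have := BPl a x 0 y; rewrite bil0x !addr0. Qed.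

Lemma bilZr a x y : B x (a *: y) = a *: B x y.
Proof. by have := BPr a x y 0; rewrite bilx0 !addr0. Qed.

Lemma bilC_ind a x x' y : B x y + B y x = 0 -> B x' y + B y x' = 0 ->
  B (a *: x + x') y + B y (a *: x + x') = 0.
Proof. by move=> h h'; rewrite BPl BPr addrACA h' -scalerDr h scaler0 addr0. Qed.

Lemma bilxx_ind a x y : B x x = 0 -> B y y = 0 -> B x y + B y x = 0 ->
  B (a *: x + y) (a *: x + y) = 0.
Proof.
move=> hx hy h.
by rewrite BPl !BPr hx hy scaler0 addr0 add0r -scalerDr h scaler0.
Qed.

Definition bil_jacobi x y z := B x (B y z) + B y (B z x) + B z (B x y).

Lemma bil_jacobi_rot x y z : bil_jacobi x y z = bil_jacobi y z x.
Proof. by rewrite /bil_jacobi -addrA addrC. Qed.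

Lemma bil_jacobi0 y z : bil_jacobi 0 y z = 0.
Proof. by rewrite /bil_jacobi !(bil0x, bilx0) !addr0. Qed.

Lemma bil_jacobi_ind a x x' y z :
  bil_jacobi x y z = 0 -> bil_jacobi x' y z = 0 ->
  bil_jacobi (a *: x + x') y z = 0.
Proof.
rewrite /bil_jacobi => h h'; rewrite !(BPl, BPr).
rewrite (addrACA (a *: _)) (addrACA (a *: _ + a *: _)) h' -!scalerDr h.
by rewrite scaler0 addr0.
Qed.

End Bilinear.

Section LieTheory.
Variables (K : fieldType) (L : lieAlgType K).
Implicit Types x y z : L.

Lemma bracketDl x y z : [Lie x + y, z] = [Lie x, z] + [Lie y, z].
Proof. exact/bilDl/bracketPl. Qed.

Lemma bracketDr x y z : [Lie x, y + z] = [Lie x, y] + [Lie x, z].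
Proof. exact/bilDr/bracketPr. Qed.

Lemma bracket0x x : [Lie 0, x] = 0.
Proof. exact/bil0x/bracketPl. Qed.

Lemma bracketx0 x : [Lie x, 0] = 0.
Proof. exact/bilx0/bracketPr. Qed.

Lemma bracketZl a x y : [Lie a *: x, y] = a *: [Lie x, y].
Proof. exact/bilZl/bracketPl. Qed.

Lemma bracketZr a x y : [Lie x, a *: y] = a *: [Lie x, y].
Proof. exact/bilZr/bracketPr. Qed.

Lemma bracketC x y : [Lie x, y] = - [Lie y, x].
Proof.
apply/eqP; rewrite -addr_eq0; apply/eqP.
by have := bracketxx (x + y); rewrite bracketDl !bracketDr !bracketxx add0r addr0.
Qed.

End LieTheory.

Definition lin_span (K : fieldType) (V : lmodType K) (X : set V) : set V :=
  [set v | exists n (a : 'I_n -> K) (x : 'I_n -> V),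
     (forall i, X (x i)) /\ v = \sum_(i < n) a i *: x i]%classic.

(** Finitely supported functions [I -> V], i.e. the direct sum over [I] of
    copies of [V]; [<< v *g i >>] is the vector [v] put in position [i].
    The library only makes [{malg V[I]}] a module when [V] is a ring. *)
Definition dsum (K : fieldType) (V : lmodType K) (I : choiceType) : Type :=
  {malg V[I]}.

Section DirectSum.
Variables (K : fieldType) (V : lmodType K) (I : choiceType).

HB.instance Definition _ := GRing.Zmodule.on (dsum V I).

Definition dsum_scale (a : K) (f : dsum V I) : dsum V I :=
  [malg i in msupp f => a *: f@_i].

Lemma dsum_scaleE a f i : (dsum_scale a f)@_i = a *: f@_i.
Proof. by rewrite mcoeffE; case: msuppP => //; rewrite scaler0. Qed.

Fact dsum_scaleA a b f : dsum_scale a (dsum_scale b f) = dsum_scale (a * b) f.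
Proof. by apply/malgP => i; rewrite !dsum_scaleE scalerA. Qed.

Fact dsum_scale1 : left_id 1 dsum_scale.
Proof. by move=> f; apply/malgP => i; rewrite dsum_scaleE scale1r. Qed.

Fact dsum_scaleDr : right_distributive dsum_scale +%R.
Proof. by move=> a f g; apply/malgP => i; rewrite !(dsum_scaleE, mcoeffD) scalerDr. Qed.

Fact dsum_scaleDl f : {morph dsum_scale^~ f : a b / a + b}.
Proof. by move=> a b; apply/malgP => i; rewrite !(dsum_scaleE, mcoeffD) scalerDl. Qed.

HB.instance Definition _ := GRing.Zmodule_isLmodule.Build K (dsum V I)
  dsum_scaleA dsum_scale1 dsum_scaleDr dsum_scaleDl.

Lemma dsumZE a (f : dsum V I) i : (a *: f)@_i = a *: f@_i.
Proof. exact: dsum_scaleE. Qed.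

Lemma dsumZU a v i : a *: (<< v *g i >> : dsum V I) = << a *: v *g i >>.
Proof.
by apply/malgP => j; rewrite dsumZE !mcoeffU; case: eqP; rewrite ?scaler0.
Qed.

Lemma dsumPU a u v i :
  << a *: u + v *g i >> = a *: (<< u *g i >> : dsum V I) + << v *g i >>.
Proof. by rewrite dsumZU -monalgUD. Qed.

Lemma dsum_ind (P : dsum V I -> Prop) :
  P 0 -> (forall a x y, P x -> P y -> P (a *: x + y)) ->
  (forall v i, P << v *g i >>) -> forall x, P x.
Proof.
move=> P0 PD PU x; rewrite (monalgE x); apply: big_ind => // y z Py Pz.
by have := PD 1 y z Py Pz; rewrite scale1r.
Qed.

Definition dsum_ext (W : lmodType K) (F : I -> V -> W) (f : dsum V I) : W :=
  \sum_(i <- msupp f) F i f@_i.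

Section Ext.
Variables (W : lmodType K) (F : I -> V -> W).
Hypothesis F_lin : forall i a u v, F i (a *: u + v) = a *: F i u + F i v.

Let F0 i : F i 0 = 0.
Proof.
apply: (addrI (F i 0)).
by rewrite addr0 -{1}[F i 0]scale1r -F_lin scale1r addr0.
Qed.

Lemma dsum_extEw (A : {fset I}) (f : dsum V I) : (msupp f `<=` A)%fset ->
  dsum_ext F f = \sum_(i <- A) F i f@_i.
Proof.
move=> fA; rewrite /dsum_ext; apply: big_fset_incl => // i _.
by move=> /mcoeff_outdom ->.
Qed.

Lemma dsum_ext_linear a f g :
  dsum_ext F (a *: f + g) = a *: dsum_ext F f + dsum_ext F g.
Proof.
pose A := (msupp (a *: f + g) `|` msupp f `|` msupp g)%fset.
rewrite (@dsum_extEw A (_ + _)); last first.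
  by apply/fsubsetP => i ii; rewrite !inE ii.
rewrite (@dsum_extEw A f); last first.
  by apply/fsubsetP => i ii; rewrite !inE ii orbT.
rewrite (@dsum_extEw A g); last first.
  by apply/fsubsetP => i ii; rewrite !inE ii !orbT.
rewrite scaler_sumr -big_split; apply: eq_bigr => i _ /=.
by rewrite mcoeffD dsumZE F_lin.
Qed.

Lemma dsum_extU v i : dsum_ext F << v *g i >> = F i v.
Proof.
by rewrite (@dsum_extEw [fset i]%fset) ?msuppU_le // big_seq_fset1 mcoeffUU.
Qed.

End Ext.
End DirectSum.

Definition gl (K : fieldType) (n : nat) : Type := 'M[K]_n.

Section GL.
Variables (K : fieldType) (n : nat).

HB.instance Definition _ := GRing.Lmodule.on (gl K n).

Definition gl_bracket (X Y : gl K n) : gl K n := X *m Y - Y *m X.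

Fact gl_bracketPl a X Y Z :
  gl_bracket (a *: X + Y) Z = a *: gl_bracket X Z + gl_bracket Y Z.
Proof.
by rewrite /gl_bracket mulmxDl mulmxDr -!scalemxAl -!scalemxAr scalerBr addrACA opprD.
Qed.

Fact gl_bracketPr a X Y Z :
  gl_bracket X (a *: Y + Z) = a *: gl_bracket X Y + gl_bracket X Z.
Proof.
by rewrite /gl_bracket mulmxDl mulmxDr -!scalemxAl -!scalemxAr scalerBr addrACA opprD.
Qed.

Fact gl_bracketxx X : gl_bracket X X = 0.
Proof. exact: subrr. Qed.

Fact gl_bracket_jacobi X Y Z :
  gl_bracket X (gl_bracket Y Z) + gl_bracket Y (gl_bracket Z X)
  + gl_bracket Z (gl_bracket X Y) = 0.
Proof.
rewrite /gl_bracket !mulmxBl !mulmxBr !mulmxA.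
apply/matrixP => i j; rewrite !mxE; ring.
Qed.

HB.instance Definition _ := Lmodule_isLieAlgebra.Build K (gl K n)
  gl_bracketPl gl_bracketPr gl_bracketxx gl_bracket_jacobi.

End GL.

(** [g (x) C[t, t^-1]], graded by the powers of [t]. *)
Definition loop (K : fieldType) (g : lieAlgType K) : Type := dsum g int.

Section Loop.
Variables (K : fieldType) (g : lieAlgType K).

HB.instance Definition _ := GRing.Lmodule.on (loop g).

(** [x (x) t^m] *)
Definition loopt (x : g) (m : int) : loop g := << x *g m >>.

Lemma looptP a u v m : loopt (a *: u + v) m = a *: loopt u m + loopt v m.
Proof. exact: dsumPU. Qed.

Lemma looptD u v m : loopt (u + v) m = loopt u m + loopt v m.
Proof. exact: monalgUD. Qed.

Lemma loopt0 m : loopt 0 m = 0.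
Proof. exact: monalgU0. Qed.

Lemma loop_ind (P : loop g -> Prop) :
  P 0 -> (forall a x y, P x -> P y -> P (a *: x + y)) ->
  (forall v m, P (loopt v m)) -> forall x, P x.
Proof. exact: dsum_ind. Qed.

Definition loop_bracket (f h : loop g) : loop g :=
  dsum_ext (fun m x => dsum_ext (fun n y => loopt [Lie x, y] (m + n)) h) f.

Let inner_lin (x : g) m n a (u v : g) :
  loopt [Lie x, a *: u + v] (m + n)
  = a *: loopt [Lie x, u] (m + n) + loopt [Lie x, v] (m + n).
Proof. by rewrite bracketPr looptP. Qed.

Let outer_lin (h : loop g) (m : int) a (u v : g) :
  dsum_ext (fun n y => loopt [Lie a *: u + v, y] (m + n)) h
  = a *: dsum_ext (fun n y => loopt [Lie u, y] (m + n)) h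
    + dsum_ext (fun n y => loopt [Lie v, y] (m + n)) h.
Proof.
rewrite /dsum_ext scaler_sumr -big_split; apply: eq_bigr => n _ /=.
by rewrite bracketPl looptP.
Qed.

Fact loop_bracketPl a x y z :
  loop_bracket (a *: x + y) z = a *: loop_bracket x z + loop_bracket y z.
Proof. exact: dsum_ext_linear. Qed.

Fact loop_bracketPr a x y z :
  loop_bracket x (a *: y + z) = a *: loop_bracket x y + loop_bracket x z.
Proof.
rewrite /loop_bracket [LHS]/dsum_ext.
under eq_bigr => m _ do rewrite dsum_ext_linear //.
by rewrite big_split -scaler_sumr.
Qed.

Lemma loop_bracketUU (x y : g) m n :
  loop_bracket (loopt x m) (loopt y n) = loopt [Lie x, y] (m + n).
Proof. by rewrite /loop_bracket dsum_extU // dsum_extU. Qed.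

Let bC x y : loop_bracket x y + loop_bracket y x = 0.
Proof.
have [Pl Pr] := (loop_bracketPl, loop_bracketPr).
elim/loop_ind: x => [|a x x' Hx Hx'|u m]; first by rewrite (bil0x Pl) (bilx0 Pr) addr0.
  exact: bilC_ind.
elim/loop_ind: y => [|a y y' Hy Hy'|v n]; first by rewrite (bilx0 Pr) (bil0x Pl) addr0.
  by rewrite addrC; apply: bilC_ind => //; rewrite addrC.
by rewrite !loop_bracketUU [n + m]addrC -looptD [[Lie u, v]]bracketC addNr loopt0.
Qed.

Fact loop_bracketxx x : loop_bracket x x = 0.
Proof.
have [Pl Pr] := (loop_bracketPl, loop_bracketPr).
elim/loop_ind: x => [|a x y Hx Hy|u m]; first exact: bil0x.
  exact: bilxx_ind.
by rewrite loop_bracketUU bracketxx loopt0.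
Qed.

Fact loop_bracket_jacobi x y z : bil_jacobi loop_bracket x y z = 0.
Proof.
have [Pl Pr] := (loop_bracketPl, loop_bracketPr).
elim/loop_ind: x => [|a x x' Hx Hx'|u m].
- exact: bil_jacobi0.
- exact: bil_jacobi_ind.
rewrite bil_jacobi_rot; elim/loop_ind: y => [|a y y' Hy Hy'|v n].
- exact: bil_jacobi0.
- exact: bil_jacobi_ind.
rewrite bil_jacobi_rot; elim/loop_ind: z => [|a z z' Hz Hz'|w p].
- exact: bil_jacobi0.
- exact: bil_jacobi_ind.
rewrite /bil_jacobi !loop_bracketUU.
have -> : m + (n + p) = p + (m + n) by ring.
have -> : n + (p + m) = p + (m + n) by ring.
by rewrite -!looptD bracket_jacobi loopt0.
Qed.

HB.instance Definition _ := Lmodule_isLieAlgebra.Build K (loop g)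
  loop_bracketPl loop_bracketPr loop_bracketxx loop_bracket_jacobi.

Lemma bracket_loopt (x y : g) m n :
  [Lie loopt x m, loopt y n] = loopt [Lie x, y] (m + n).
Proof. exact: loop_bracketUU. Qed.

End Loop.

Section FixedPoints.
Variables (K : fieldType) (L : lieAlgType K) (f : {lie L -> L}).

Definition fixed_pred : {pred L} := [pred x | f x == x].

Fact fixed_submod_closed : submod_closed fixed_pred.
Proof.
split=> [|a x y]; rewrite !inE ?linear0 // => /eqP fx /eqP fy.
by rewrite linearP /= fx fy.
Qed.

HB.instance Definition _ :=
  GRing.isSubmodClosed.Build K L fixed_pred fixed_submod_closed.

Record fixed_alg := FixedAlg { fixed_val : L; _ : fixed_val \in fixed_pred }.

HB.instance Definition _ := [isSub for fixed_val].
HB.instance Definition _ := [Choice of fixed_alg by <:].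
HB.instance Definition _ := [SubChoice_isSubLmodule of fixed_alg by <:].

Lemma fixed_valP a (x y : fixed_alg) :
  fixed_val (a *: x + y) = a *: fixed_val x + fixed_val y.
Proof. by []. Qed.

Lemma fixed_valD (x y : fixed_alg) :
  fixed_val (x + y) = fixed_val x + fixed_val y.
Proof. by []. Qed.

Lemma fixed_val0 : fixed_val 0 = 0.
Proof. by []. Qed.

Fact fixed_bracket_closed (x y : fixed_alg) :
  [Lie val x, val y] \in fixed_pred.
Proof.
case: x y => [x /= /eqP fx] [y /= /eqP fy].
by rewrite inE lie_morphism_subproof fx fy.
Qed.

Definition fixed_bracket (x y : fixed_alg) : fixed_alg :=
  FixedAlg (fixed_bracket_closed x y).

Fact fixed_bracketPl a x y z :
  fixed_bracket (a *: x + y) z = a *: fixed_bracket x z + fixed_bracket y z.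
Proof. by apply: val_inj; exact: bracketPl. Qed.

Fact fixed_bracketPr a x y z :
  fixed_bracket x (a *: y + z) = a *: fixed_bracket x y + fixed_bracket x z.
Proof. by apply: val_inj; exact: bracketPr. Qed.

Fact fixed_bracketxx x : fixed_bracket x x = 0.
Proof. by apply: val_inj; exact: bracketxx. Qed.

Fact fixed_bracket_jacobi x y z :
  fixed_bracket x (fixed_bracket y z) + fixed_bracket y (fixed_bracket z x)
  + fixed_bracket z (fixed_bracket x y) = 0.
Proof. by apply: val_inj; exact: bracket_jacobi. Qed.

HB.instance Definition _ := Lmodule_isLieAlgebra.Build K fixed_alg
  fixed_bracketPl fixed_bracketPr fixed_bracketxx fixed_bracket_jacobi.

End FixedPoints.

Section Twist.
Variables (K : fieldType) (g : lieAlgType K) (f : {lie g -> g}).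
Variables (e : K) (e_neq0 : e != 0).

(** [a (x) t^m |-> e^(-m) (f(a) (x) t^m)] *)
Definition loop_twist (_ : e != 0) (x : loop g) : loop g :=
  dsum_ext (fun (m : int) a => e ^ (- m) *: loopt (f a) m) x.

Let base_lin (m : int) a u v : e ^ (- m) *: loopt (f (a *: u + v)) m
  = a *: (e ^ (- m) *: loopt (f u) m) + e ^ (- m) *: loopt (f v) m.
Proof. by rewrite linearP looptP scalerDr !scalerA mulrC. Qed.

Fact loop_twist_linear : linear (loop_twist e_neq0).
Proof. by move=> a x y; apply: dsum_ext_linear. Qed.

HB.instance Definition _ := GRing.isLinear.Build K (loop g) (loop g) *:%R
  (loop_twist e_neq0) loop_twist_linear.

Lemma loop_twistU a m :
  loop_twist e_neq0 (loopt a m) = e ^ (- m) *: loopt (f a) m.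
Proof. exact: dsum_extU. Qed.

Fact loop_twist_lie (x y : loop g) :
  loop_twist e_neq0 [Lie x, y] = [Lie loop_twist e_neq0 x, loop_twist e_neq0 y].
Proof.
elim/loop_ind: x => [|a x x' Hx Hx'|u m].
- by rewrite !(bracket0x, linear0).
- by rewrite bracketPl !linearP /= Hx Hx' bracketPl.
elim/loop_ind: y => [|a y y' Hy Hy'|v n].
- by rewrite !(bracketx0, linear0).
- by rewrite bracketPr !linearP /= Hy Hy' bracketPr.
rewrite bracket_loopt !loop_twistU bracketZl bracketZr bracket_loopt.
by rewrite scalerA -expfzDr // opprD lie_morphism_subproof.
Qed.

HB.instance Definition _ := isLieMorphism.Build K (loop g) (loop g)
  (loop_twist e_neq0) loop_twist_lie.

End Twist.

(** Linear characters of an abelian group; the values are automatically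
    nonzero. *)
Record lin_char (K : fieldType) (S : zmodType) := LinChar {
  lin_char_val :> S -> K;
  lin_char0 : lin_char_val 0 = 1;
  lin_charD : forall a b, lin_char_val (a + b) = lin_char_val a * lin_char_val b
}.

(** The vector space with basis [c] (index [None]) and [A_{alpha,m}] (index
    [Some (alpha, m)]). That the bracket below makes it the Lie algebra
    presented by the relations is [Ahat_universal]. *)
Definition Ahat (K : fieldType) (S : zmodType) (chi : lin_char K S) : Type :=
  dsum K^o (option (S * int)).

Section Ahat.
Variables (K : fieldType) (S : zmodType) (chi : lin_char K S).

HB.instance Definition _ := GRing.Lmodule.on (Ahat chi).

Definition Ahat_c : Ahat chi := << (1 : K^o) *g None >>.
Definition Ahat_A (a : S) (m : int) : Ahat chi := << (1 : K^o) *g Some (a, m) >>.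

Definition Ahat_basis (i : option (S * int)) : Ahat chi :=
  if i is Some (a, m) then Ahat_A a m else Ahat_c.

Definition Ahat_coef (a : S) (m : int) (b : S) (n : int) : K :=
  chi (b *~ m - a *~ n) - chi (a *~ n - b *~ m).

Definition Ahat_central (a : S) (m : int) (b : S) (n : int) : K :=
  m%:~R * (a + b == 0)%:R * (m + n == 0)%:R.

Definition Ahat_basis_bracket (i j : option (S * int)) : Ahat chi :=
  match i, j with
  | Some (a, m), Some (b, n) =>
      Ahat_coef a m b n *: Ahat_A (a + b) (m + n)
      + Ahat_central a m b n *: Ahat_c
  | _, _ => 0
  end.

Definition Ahat_bracket (x y : Ahat chi) : Ahat chi :=
  dsum_ext (fun i (u : K^o) =>
    dsum_ext (fun j (v : K^o) =>
      ((u : K) * (v : K)) *: Ahat_basis_bracket i j) y) x.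

Lemma Ahat_ind (P : Ahat chi -> Prop) :
  P 0 -> (forall a x y, P x -> P y -> P (a *: x + y)) ->
  (forall i, P (Ahat_basis i)) -> forall x, P x.
Proof.
move=> P0 PD PB; apply: dsum_ind => // v i.
have -> : (<< v *g i >> : Ahat chi) = v *: Ahat_basis i + 0.
  rewrite addr0; have -> : Ahat_basis i = << (1 : K^o) *g i >>.
    by case: i => [[]|].
  apply: etrans (esym (dsumZU v (1 : K^o) i)).
  by rewrite [v *: _]mulr1.
exact: PD.
Qed.

Fact Ahat_bracketPl a x y z :
  Ahat_bracket (a *: x + y) z = a *: Ahat_bracket x z + Ahat_bracket y z.
Proof.
apply: dsum_ext_linear => i b u v; rewrite /dsum_ext scaler_sumr -big_split.
by apply: eq_bigr => j _ /=; rewrite mulrDl scalerDl scalerA mulrA.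
Qed.

Fact Ahat_bracketPr a x y z :
  Ahat_bracket x (a *: y + z) = a *: Ahat_bracket x y + Ahat_bracket x z.
Proof.
rewrite /Ahat_bracket [LHS]/dsum_ext.
under eq_bigr => m _.
  rewrite dsum_ext_linear; last first.
    by move=> j b u v; rewrite mulrDr scalerDl scalerA mulrCA.
  over.
by rewrite big_split -scaler_sumr.
Qed.

Let bracketBB i j :
  Ahat_bracket (Ahat_basis i) (Ahat_basis j) = Ahat_basis_bracket i j.
Proof.
have E k : Ahat_basis k = << (1 : K^o) *g k >> by case: k => [[]|].
rewrite !E /Ahat_bracket dsum_extU; last first.
  move=> k b u v; rewrite /dsum_ext scaler_sumr -big_split.
  by apply: eq_bigr => l _ /=; rewrite mulrDl scalerDl scalerA mulrA.
rewrite dsum_extU; first by rewrite mulr1 scale1r.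
by move=> l b u v; rewrite mulrDr scalerDl scalerA mulrCA.
Qed.

Lemma Ahat_coefC a m b n : Ahat_coef a m b n = - Ahat_coef b n a m.
Proof. by rewrite /Ahat_coef opprB. Qed.

Lemma Ahat_centralC a m b n : Ahat_central a m b n = - Ahat_central b n a m.
Proof.
rewrite /Ahat_central [b + a]addrC [n + m]addrC.
have [|] := boolP (m + n == 0); last by rewrite !mulr0 oppr0.
by rewrite (addr_eq0 m) => /eqP ->; rewrite mulrNz !mulNr.
Qed.

Let bbC i j : Ahat_basis_bracket i j + Ahat_basis_bracket j i = 0.
Proof.
case: i j => [[a m]|] [[b n]|] //=; rewrite ?addr0 //.
rewrite [b + a]addrC [n + m]addrC Ahat_coefC Ahat_centralC.
by rewrite addrACA -!scalerDl !addNr !scale0r addr0.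
Qed.

Let bbxx i : Ahat_basis_bracket i i = 0.
Proof.
case: i => [[a m]|] //=; rewrite /Ahat_coef /Ahat_central !subrr scale0r add0r.
have [->|m0] := eqVneq m 0; first by rewrite !mul0r scale0r.
by rewrite -(mulr2n m) mulrn_eq0 /= (negPf m0) mulr0 scale0r.
Qed.

Let pair a m b n := chi (b *~ m - a *~ n).

Let coefE a m b n : Ahat_coef a m b n = pair a m b n - pair b n a m.
Proof. by []. Qed.

Let pairDr a m b n d p : pair a m (b + d) (n + p) = pair a m b n * pair a m d p.
Proof. by rewrite /pair mulrzDl mulrzDr opprD addrACA lin_charD. Qed.

Let pairDl a m b n d p : pair (b + d) (n + p) a m = pair b n a m * pair d p a m.
Proof. by rewrite /pair mulrzDl mulrzDr opprD addrACA lin_charD. Qed.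

Let pairN a m b n :
  pair (- a) (- m) b n = pair b n a m.
Proof. by rewrite /pair mulrNz mulNrz opprK addrC. Qed.

Let pairNr a m b n :
  pair b n (- a) (- m) = pair a m b n.
Proof. by rewrite /pair mulrNz mulNrz opprK addrC. Qed.

Let pairxx a m : pair a m a m = 1.
Proof. by rewrite /pair subrr lin_char0. Qed.

Lemma Ahat_jacobi_gen (V : lmodType K) (B : V -> V -> V)
    (A : S -> int -> V) (c : V) :
  (forall k x y z, B x (k *: y + z) = k *: B x y + B x z) ->
  (forall x, B x c = 0) ->
  (forall a m b n, B (A a m) (A b n) =
    Ahat_coef a m b n *: A (a + b) (m + n) + Ahat_central a m b n *: c) ->
  forall a m b n d p, bil_jacobi B (A a m) (A b n) (A d p) = 0.
Proof.
move=> Pr xc AE a m b n d p.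
have H a1 m1 b1 n1 d1 p1 :
    B (A a1 m1) (B (A b1 n1) (A d1 p1))
    = (Ahat_coef b1 n1 d1 p1 * Ahat_coef a1 m1 (b1 + d1) (n1 + p1))
        *: A (a1 + (b1 + d1)) (m1 + (n1 + p1))
      + (Ahat_coef b1 n1 d1 p1 * Ahat_central a1 m1 (b1 + d1) (n1 + p1))
        *: c.
  by rewrite AE Pr AE (bilZr Pr) xc scaler0 addr0 scalerDr !scalerA.
rewrite /bil_jacobi !H.
have -> : b + (d + a) = a + (b + d) by rewrite addrA addrC.
have -> : d + (a + b) = a + (b + d) by rewrite addrC -addrA.
have -> : n + (p + m) = m + (n + p) by ring.
have -> : p + (m + n) = m + (n + p) by ring.
rewrite (addrACA (_ *: _)) (addrACA (_ *: _ + _ *: _)) -!scalerDl.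
set k1 := (X in X *: _); set k2 := (X in _ + X *: _).
suff [-> ->] : k1 = 0 /\ k2 = 0 by rewrite !scale0r addr0.
rewrite {}/k1 {}/k2; split.
  by rewrite !coefE !pairDl !pairDr; ring.
rewrite /Ahat_central.
have -> : b + (d + a) = a + (b + d) by rewrite addrA addrC.
have -> : d + (a + b) = a + (b + d) by rewrite addrC -addrA.
have -> : n + (p + m) = m + (n + p) by ring.
have -> : p + (m + n) = m + (n + p) by ring.
have [/eqP e1|] := boolP (a + (b + d) == 0); last by rewrite !(mulr0, mul0r) !addr0.
have [/eqP e2|] := boolP (m + (n + p) == 0); last by rewrite !(mulr0, mul0r) !addr0.
have -> : d = - (a + b) by apply/eqP; rewrite -addr_eq0 addrC -addrA e1.
have -> : p = - (m + n) by apply/eqP; rewrite -addr_eq0 addrC -addrA e2.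
have -> : Ahat_coef b n (- (a + b)) (- (m + n)) = Ahat_coef a m b n.
  by rewrite !coefE !(pairN, pairNr) !pairDl !pairDr !pairxx !mulr1.
have -> : Ahat_coef (- (a + b)) (- (m + n)) a m = Ahat_coef a m b n.
  by rewrite !coefE !(pairN, pairNr) !pairDl !pairDr !pairxx !mul1r.
by rewrite -!mulrDr; ring.
Qed.

Let bC x y : Ahat_bracket x y + Ahat_bracket y x = 0.
Proof.
have [Pl Pr] := (Ahat_bracketPl, Ahat_bracketPr).
elim/Ahat_ind: x => [|a x x' Hx Hx'|i]; first by rewrite (bil0x Pl) (bilx0 Pr) addr0.
  exact: (bilC_ind Pl Pr _ Hx Hx').
elim/Ahat_ind: y => [|a y y' Hy Hy'|j]; first by rewrite (bilx0 Pr) (bil0x Pl) addr0.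
  move: Hy Hy'; rewrite ![Ahat_bracket (Ahat_basis i) _ + _]addrC => Hy Hy'.
  exact: (bilC_ind Pl Pr _ Hy Hy').
by rewrite !bracketBB.
Qed.

Fact Ahat_bracketxx x : Ahat_bracket x x = 0.
Proof.
have [Pl Pr] := (Ahat_bracketPl, Ahat_bracketPr).
elim/Ahat_ind: x => [|a x y Hx Hy|i]; first exact: (bil0x Pl).
  exact: (bilxx_ind Pl Pr _ Hx Hy (bC _ _)).
by rewrite bracketBB.
Qed.

Let AE a m b n : Ahat_bracket (Ahat_A a m) (Ahat_A b n) =
  Ahat_coef a m b n *: Ahat_A (a + b) (m + n) + Ahat_central a m b n *: Ahat_c.
Proof. exact: (bracketBB (Some (a, m)) (Some (b, n))). Qed.

Let cx x : Ahat_bracket Ahat_c x = 0.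
Proof.
elim/Ahat_ind: x => [|a x y Hx Hy|i].
- exact/bilx0/Ahat_bracketPr.
- by rewrite Ahat_bracketPr Hx Hy scaler0 addr0.
- exact: (bracketBB None).
Qed.

Let xc x : Ahat_bracket x Ahat_c = 0.
Proof. by have := bC x Ahat_c; rewrite cx addr0. Qed.

Let jacobiA a m b n d p :
  bil_jacobi Ahat_bracket (Ahat_A a m) (Ahat_A b n) (Ahat_A d p) = 0.
Proof. exact: (Ahat_jacobi_gen Ahat_bracketPr xc AE). Qed.

Let bil_jacobi_c x y : bil_jacobi Ahat_bracket Ahat_c x y = 0.
Proof.
by rewrite /bil_jacobi !(cx, xc) !(bilx0 Ahat_bracketPr) !addr0.
Qed.

Fact Ahat_bracket_jacobi x y z : bil_jacobi Ahat_bracket x y z = 0.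
Proof.
have [Pl Pr] := (Ahat_bracketPl, Ahat_bracketPr).
elim/Ahat_ind: x => [|a x x' Hx Hx'|i].
- exact: (bil_jacobi0 Pl Pr).
- exact: (bil_jacobi_ind Pl Pr _ Hx Hx').
rewrite bil_jacobi_rot; elim/Ahat_ind: y => [|a y y' Hy Hy'|j].
- exact: (bil_jacobi0 Pl Pr).
- exact: (bil_jacobi_ind Pl Pr _ Hy Hy').
rewrite bil_jacobi_rot; elim/Ahat_ind: z => [|a z z' Hz Hz'|k].
- exact: (bil_jacobi0 Pl Pr).
- exact: (bil_jacobi_ind Pl Pr _ Hz Hz').
case: k => [[d p]|]; last exact: bil_jacobi_c.
rewrite bil_jacobi_rot; case: i => [[a m]|]; last exact: bil_jacobi_c.
rewrite bil_jacobi_rot; case: j => [[b n]|]; last exact: bil_jacobi_c.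
exact: jacobiA.
Qed.

HB.instance Definition _ := Lmodule_isLieAlgebra.Build K (Ahat chi)
  Ahat_bracketPl Ahat_bracketPr Ahat_bracketxx Ahat_bracket_jacobi.

Lemma bracket_Ahat_c (x : Ahat chi) : [Lie Ahat_c, x] = 0.
Proof. exact: cx. Qed.

Lemma bracket_Ahat_A a m b n :
  [Lie Ahat_A a m, Ahat_A b n] =
    (chi (b *~ m - a *~ n) - chi (a *~ n - b *~ m)) *: Ahat_A (a + b) (m + n)
    + (m%:~R * (a + b == 0)%:R * (m + n == 0)%:R) *: Ahat_c.
Proof. exact: AE. Qed.

(** [Ahat chi] is the Lie algebra generated by [c] and the [A_{alpha,m}]
    subject to the above relations. *)
Theorem Ahat_universal (L : lieAlgType K) (c : L) (A : S -> int -> L) :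
  (forall a m, [Lie c, A a m] = 0) ->
  (forall a m b n, [Lie A a m, A b n] =
    (chi (b *~ m - a *~ n) - chi (a *~ n - b *~ m)) *: A (a + b) (m + n)
    + (m%:~R * (a + b == 0)%:R * (m + n == 0)%:R) *: c) ->
  exists f : {lie Ahat chi -> L},
    [/\ f Ahat_c = c, forall a m, f (Ahat_A a m) = A a m
      & forall g : {lie Ahat chi -> L}, g Ahat_c = c ->
          (forall a m, g (Ahat_A a m) = A a m) -> g =1 f].
Proof.
move=> cC AA; pose B i := if i is Some (a, m) then A a m else c.
pose f (x : Ahat chi) : L := dsum_ext (fun i (u : K^o) => (u : K) *: B i) x.
have f_lin : linear f.
  move=> a x y; apply: dsum_ext_linear => i b u v.
  by rewrite scalerDl scalerA.
have fB i : f (Ahat_basis i) = B i.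
  have -> : Ahat_basis i = << (1 : K^o) *g i >> by case: i => [[]|].
  rewrite /f dsum_extU ?scale1r // => j b u v.
  by rewrite scalerDl scalerA.
pose fl := GRing.isLinear.Build K (Ahat chi) L *:%R f f_lin.
pose F : {linear Ahat chi -> L} := HB.pack f fl.
have FB i : F (Ahat_basis i) = B i by exact: fB.
have FA a m : F (Ahat_A a m) = A a m by exact: (fB (Some (a, m))).
have Fc : F Ahat_c = c by exact: (fB None).
have F0 : F 0 = 0 by exact: (linear0 F).
have f_lie (x y : Ahat chi) : F [Lie x, y] = [Lie F x, F y].
  elim/Ahat_ind: x => [|a x x' Hx Hx'|i].
  - by rewrite !(bracket0x, linear0).
  - by rewrite bracketPl !(linearP F) Hx Hx' bracketPl.
  elim/Ahat_ind: y => [|a y y' Hy Hy'|j].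
  - by rewrite !(bracketx0, linear0).
  - by rewrite bracketPr !(linearP F) Hy Hy' bracketPr.
  rewrite !FB; case: i j => [[a m]|] [[b n]|].
  - rewrite [X in F X]bracket_Ahat_A (linearP F) FA AA; congr (_ + _).
    by rewrite -Fc; exact: (linearZ_LR F).
  - have -> : [Lie Ahat_basis (Some (a, m)), Ahat_basis None] = 0.
      by rewrite bracketC bracket_Ahat_c oppr0.
    by rewrite F0 bracketC cC oppr0.
  - by rewrite bracket_Ahat_c F0 cC.
  - by rewrite bracket_Ahat_c F0 bracketxx.
pose Fl := isLieMorphism.Build K (Ahat chi) L f f_lie.
pose G : {lie Ahat chi -> L} := HB.pack f fl Fl.
exists G; split=> [|a m|g gc gA x].
- exact: (fB None).
- exact: (fB (Some (a, m))).
elim/Ahat_ind: x => [|a x y Hx Hy|i]; first by rewrite !linear0.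
  by rewrite !linearP /= Hx Hy.
rewrite [RHS]fB; case: i => [[a m]|] /=; [exact: gA|exact: gc].
Qed.

End Ahat.

Section Chi.
Variables (R : realType) (l : nat).

(** [e^(i t)] for real [t] *)
Definition expi (t : R) : R[i] := (cos t +i* sin t)%C.

Definition chiZ (m : int) : R[i] := expi (2 * pi * m%:~R / (2 * l%:R)).

Lemma chiZ0 : chiZ 0 = 1.
Proof. by rewrite /chiZ /expi mulr0 mul0r cos0 sin0. Qed.

Lemma chiZD m n : chiZ (m + n) = chiZ m * chiZ n.
Proof.
rewrite /chiZ /expi intrD mulrDr mulrDl cosD sinD.
by apply/eqP; rewrite eq_complex /= eqxx addrC [X in X + _]mulrC eqxx.
Qed.

Lemma chiZ_neq0 m : chiZ m != 0.
Proof.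
apply/eqP => h; have /eqP := chiZ0.
by rewrite -(subrr m) chiZD h mul0r eq_sym oner_eq0.
Qed.

Lemma chiZ_period (l_gt0 : (0 < l)%N) (k : int) : chiZ (k * (2 * l)%N%:Z) = 1.
Proof.
have E : chiZ (2 * l)%N%:Z = 1.
  have t2pi : 2 * pi * (2 * l)%N%:Z%:~R / (2 * l%:R) = pi *+ 2 :> R.
    by rewrite -pmulrn natrM; field; rewrite pnatr_eq0 -lt0n.
  by rewrite /chiZ /expi t2pi cos2pi sin2pi.
have H (n : nat) : chiZ (n%:Z * (2 * l)%N%:Z) = 1.
  elim: n => [|n IH]; first by rewrite mul0r chiZ0.
  by rewrite intS mulrDl mul1r chiZD E IH mulr1.
case: (intP k) => [|n|n]; first by rewrite mul0r chiZ0.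
  exact: H.
have := chiZD (- (n.+1%:Z) * (2 * l)%N%:Z) (n.+1%:Z * (2 * l)%N%:Z).
by rewrite -mulrDl addNr mul0r chiZ0 H mulr1.
Qed.

End Chi.

(** From here on the positive integer [l] is written [n.+1]. *)
Section Data.
Variables (R : realType) (n : nat).
Local Notation l := (n.+1).
Local Notation chi := (@chiZ R l).

Definition chiS_fun (a : 'Z_(2 * l)) : R[i] := chi (a : nat)%:Z.

Let chi_modn (k : nat) : chi (k %% (2 * l))%N%:Z = chi k%:Z.
Proof.
rewrite [in RHS](divn_eq k (2 * l)) PoszD PoszM chiZD.
by rewrite (chiZ_period R (ltn0Sn n)) mul1r.
Qed.

Fact chiS0 : chiS_fun 0 = 1.
Proof. exact: chiZ0. Qed.

Fact chiSD a b : chiS_fun (a + b) = chiS_fun a * chiS_fun b.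
Proof.
rewrite /chiS_fun -chiZD -PoszD -[in RHS]chi_modn /=.
move: (nat_of_ord a) (nat_of_ord b) => i j.
by rewrite Zp_cast // mulnS.
Qed.

Definition chiS : lin_char R[i] 'Z_(2 * l) := LinChar chiS0 chiSD.

Lemma chiS_class (m : int) : chiS (m%:~R) = chi m.
Proof.
have H (k : nat) : chiS k%:R = chi k%:Z.
  by rewrite /= /chiS_fun val_Zp_nat ?chi_modn // mulnS.
case: (intP m) => [|k|k]; first by rewrite mulr0z lin_char0 chiZ0.
  exact: H.
have h := chiZ_neq0 R l k.+1.
apply: (mulIf h); rewrite -[RHS]chiZD addNr chiZ0 -(H k.+1) -lin_charD.
by rewrite mulrNz -pmulrn addNr lin_char0.
Qed.

(** [A_{r,m} = A_{[r],m}] for integers [r]. *)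
Definition Ahat_Z (r m : int) : Ahat chiS := Ahat_A chiS r%:~R m.

(** Matrix indices start at [0], hence the shift by one in [Qmx]. *)
Definition Pmx : 'M[R[i]]_l :=
  \sum_(j < n) delta_mx (inord j) (inord j.+1) + delta_mx ord_max ord0.

Definition Qmx : 'M[R[i]]_l := diag_mx (\row_(j < l) chi (2 * j.+1)%N%:Z).

Definition amx (r m : int) : gl R[i] l := chi (r * m) *: (Qmx ^ r * Pmx ^ m).

Lemma Qmx_unit : Qmx \in unitmx.
Proof.
rewrite unitmxE det_diag unitfE; apply/prodf_neq0 => j _.
by rewrite mxE chiZ_neq0.
Qed.

Definition eta1 (X : gl R[i] l) : gl R[i] l := invmx Qmx *m X *m Qmx.

Fact eta1_linear : linear eta1.
Proof. by move=> a X Y; rewrite /eta1 mulmxDr mulmxDl -scalemxAr -scalemxAl. Qed.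

HB.instance Definition _ :=
  GRing.isLinear.Build R[i] (gl R[i] l) (gl R[i] l) *:%R eta1 eta1_linear.

Fact eta1_lie X Y : eta1 [Lie X, Y] = [Lie eta1 X, eta1 Y].
Proof.
have H (A B : 'M[R[i]]_l) : eta1 A *m eta1 B = eta1 (A *m B).
  rewrite /eta1 !mulmxA -[_ *m Qmx *m invmx Qmx]mulmxA mulmxV ?Qmx_unit //.
  by rewrite mulmx1.
by rewrite /bracket /= /gl_bracket !H linearB.
Qed.

HB.instance Definition _ :=
  isLieMorphism.Build R[i] (gl R[i] l) (gl R[i] l) eta1 eta1_lie.

(** [a (x) t^m |-> chi(2)^(-m) (eta1(a) (x) t^m)] *)
Definition eta1bar : loop (gl R[i] l) -> loop (gl R[i] l) :=
  loop_twist eta1 (chiZ_neq0 R l 2).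

HB.instance Definition _ := LieMorphism.on eta1bar.

(** The values prescribed for [theta_A]; they determine it, since [c] and the
    [A_{[r],m}] form the basis [Ahat_basis]. *)
Definition theta_spec
    (theta : {linear Ahat chiS -> fixed_alg eta1bar}) : Prop :=
  theta (Ahat_c chiS) = 0 /\
  forall r m : int, fixed_val (theta (Ahat_Z r m)) = loopt (amx r m) m.

End Data.

(* Main.v *)
Require Import Defs.
From HB Require Import structures.
From mathcomp Require Import all_boot all_order all_algebra.
From mathcomp Require Import complex classical_sets reals trigo ring.

Set Implicit Arguments.
Unset Strict Implicit.
Unset Printing Implicit Defensive.

Import Order.TTheory GRing.Theory Num.Theory.

Local Open Scope ring_scope.

(** Write l for the size n.+1 of the matrices and E_ij for the matrix units,
    with indices i, j running over 0, ..., l - 1 and read modulo l. The proof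
    is a computation in the basis of the E_ij (x) t^m, called cells below.

    The twisted automorphism multiplies E_ij (x) t^m by chi(2(j - i - m))
    [eta1bar_cell], so its fixed points are the combinations of the cells with
    j = i + m [cell_fixed, fixed_ind]. On the other side, a_{r,m} has the
    entry chi(r(2(i + 1) + m)) in each place (i, i + m) and zeros elsewhere
    [amxE]: for fixed m, the matrices a_{r,m} with 0 <= r < l are, up to
    phases, the discrete Fourier transforms of the l cells that are fixed in
    degree m. Everything about theta follows from this. The product of two
    matrices a_{r,m} is again one up to a power of chi [mul_amx], which gives
    the bracket relations; the central term disappears because c is sent
    to 0. Fourier inversion writes each fixed cell as the image of an
    explicit element [theta_preimage], so theta is onto. The same formula
    defines a linear map back to the abstract algebra [theta_section]. Going
    forth and back sends A_{s,m} to the multiple of A_{r,m}, with r the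
    residue of s modulo l, to which the relation A_{r+l,m} = (-1)^m A_{r,m}
    reduces it; hence an element differs from its image under the round trip
    by an element of the span, and the kernel is contained in the span
    [theta_section_theta]. The other inclusion is the sign rule [amx_shift].

    The last claim holds because eta1 is inner: conjugation by the diagonal
    matrix with entries t^i untwists it. In formulas,
    E_ij (x) t^k |-> E_ij (x) t^(kl + j - i) is an isomorphism from the full
    loop algebra onto the fixed points [wind, windK, unwindK, wind_lie]. *)

(** * Linear algebra *)

(** Used to reduce a vector to those basis vectors on which its coordinate is
    nonzero. *)
Lemma lin_closed_sum (K : fieldType) (V : lmodType K) (P : V -> Prop) :
  P 0 -> (forall a x y, P x -> P y -> P (a *: x + y)) ->
  forall (I : Type) (r : seq I) (a : I -> K) (x : I -> V),
    (forall i, a i != 0 -> P (x i)) -> P (\sum_(i <- r) a i *: x i).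
Proof.
move=> P0 PD I r a x Px; elim: r => [|i r IH]; first by rewrite big_nil.
rewrite big_cons; have [->|/Px Pi] := eqVneq (a i) 0; last exact: PD.
by rewrite scale0r add0r.
Qed.

Lemma iter_eigen (K : fieldType) (V : lmodType K) (f : {linear V -> V}) a x p :
  f x = a *: x -> iter p f x = a ^+ p *: x.
Proof.
move=> fx; elim: p => [|p IH]; first by rewrite scale1r.
by rewrite iterS IH linearZ_LR fx scalerA exprSr.
Qed.

Lemma linear_lincomb (K : fieldType) (V W : lmodType K) (f : {linear V -> W})
    (I : finType) (a : I -> K) (x : I -> V) :
  f (\sum_i a i *: x i) = \sum_i a i *: f (x i).
Proof. by rewrite linear_sum; apply: eq_bigr => i _; rewrite linearZ_LR. Qed.

Lemma exchange_lincomb (K : fieldType) (V : lmodType K) (I J : finType)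
    (a : I -> K) (b : I -> J -> K) (x : J -> V) :
  \sum_i a i *: (\sum_j b i j *: x j) = \sum_j (\sum_i a i * b i j) *: x j.
Proof.
under eq_bigr => i _ do rewrite scaler_sumr.
rewrite exchange_big; apply: eq_bigr => j _; rewrite scaler_suml.
by apply: eq_bigr => i _; rewrite scalerA.
Qed.

(** For brackets of matrix units, whose two terms carry Kronecker deltas: each
    term has to be computed only where its delta is 1. *)
Lemma linear_boolB (K : fieldType) (V W : lmodType K) (f : {linear V -> W})
    (b c : bool) x y x' y' :
  (b -> f x = x') -> (c -> f y = y') ->
  f (b%:R *: x - c%:R *: y) = b%:R *: x' - c%:R *: y'.
Proof.
by case: b c => [] [] fx fy;
   rewrite linearB !linearZ_LR /= ?scale0r ?fx ?fy.
Qed.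

Section Span.
Variables (K : fieldType) (V : lmodType K) (X : set V).

Lemma lin_span_gen x : X x -> lin_span X x.
Proof.
move=> Xx; exists 1%N, (fun=> 1), (fun=> x); split=> //.
by rewrite big_ord1 scale1r.
Qed.

Lemma lin_span0 : lin_span X 0.
Proof.
by exists 0%N, (fun=> 0), (fun=> 0); split=> [[]|]; rewrite ?big_ord0.
Qed.

Lemma lin_spanP a x y : lin_span X x -> lin_span X y -> lin_span X (a *: x + y).
Proof.
move=> [p [b [u [Xu ->]]]] [q [c [v [Xv ->]]]].
exists (p + q)%N.
exists (fun i =>
  match fintype.split i with inl j => a * b j | inr k => c k end).
exists (fun i => match fintype.split i with inl j => u j | inr k => v k end).
split=> [i|]; first by case: (fintype.split i).
rewrite big_split_ord scaler_sumr /=; congr (_ + _); apply: eq_bigr => i _.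
  by rewrite (unsplitK (inl i)) scalerA.
by rewrite (unsplitK (inr i)).
Qed.

Lemma lin_span_ker (W : lmodType K) (f : {linear V -> W}) x :
  (forall y, X y -> f y = 0) -> lin_span X x -> f x = 0.
Proof.
move=> fX [p [a [u [Xu ->]]]]; rewrite linear_sum big1 // => i _.
by rewrite linearZ_LR fX ?scaler0.
Qed.

End Span.

(** The induction step for showing that a linear map [f] is the identity
    modulo a span. *)
Lemma lin_span_subP (K : fieldType) (V : lmodType K) (X : set V) (f : V -> V)
    a x y : f (a *: x + y) = a *: f x + f y ->
  lin_span X (x - f x) -> lin_span X (y - f y) ->
  lin_span X (a *: x + y - f (a *: x + y)).
Proof. by move=> ->; rewrite opprD addrACA -scalerBr; exact: lin_spanP. Qed.

Lemma fixed_val_lincomb (K : fieldType) (L : lieAlgType K) (f : {lie L -> L})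
    (I : finType) (a : I -> K) (x : I -> fixed_alg f) :
  fixed_val (\sum_i a i *: x i) = \sum_i a i *: fixed_val (x i).
Proof. exact: (big_morph _ (@fixed_valD K L f) (fixed_val0 f)). Qed.

Lemma fixed_val_inj (K : fieldType) (L : lieAlgType K) (f : {lie L -> L}) :
  injective (@fixed_val K L f).
Proof. exact: val_inj. Qed.

Lemma fixed_val_bracket (K : fieldType) (L : lieAlgType K) (f : {lie L -> L})
    (x y : fixed_alg f) : fixed_val [Lie x, y] = [Lie fixed_val x, fixed_val y].
Proof. by []. Qed.

Lemma fixed_valZ (K : fieldType) (L : lieAlgType K) (f : {lie L -> L})
    a (x : fixed_alg f) : fixed_val (a *: x) = a *: fixed_val x.
Proof. by []. Qed.

Lemma fixed_valB (K : fieldType) (L : lieAlgType K) (f : {lie L -> L})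
    (x y : fixed_alg f) : fixed_val (x - y) = fixed_val x - fixed_val y.
Proof. by []. Qed.

(** * Values of the character chi *)

(** Computes integer powers of chi(m), P and Q from explicit families, with no
    inverse to work out. *)
Lemma exprz_morph (A : unitRingType) (g : int -> A) :
  g 0 = 1 -> (forall m k, g (m + k) = g m * g k) -> forall m, g 1 ^ m = g m.
Proof.
move=> g0 gD.
have gX (k : nat) : g 1 ^+ k = g k%:Z.
  by elim: k => [|k IH]; rewrite ?g0 // exprS IH -gD.
have gNV (k : nat) : g k%:Z * g (- k%:Z) = 1 by rewrite -gD subrr.
have gVN (k : nat) : g (- k%:Z) * g k%:Z = 1 by rewrite -gD addNr.
case/intP => [|k|k]; [by rewrite expr0z | exact: gX |].
rewrite -exprnN gX.
have gU : g k.+1%:Z \is a GRing.unit by apply/unitrP; exists (g (- k.+1%:Z)).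
by apply: (mulrI gU); rewrite mulrV // gNV.
Qed.

Section RootsOfUnity.
Variables (R : realType) (n : nat).
Local Notation l := (n.+1).
Local Notation chi := (@chiZ R l).

Lemma chiZ_mulz m k : chi (m * k) = chi m ^ k.
Proof.
rewrite -[in RHS](mulr1 m) (exprz_morph (g := fun k => chi (m * k))) //.
  by rewrite mulr0 chiZ0.
by move=> p q; rewrite mulrDr chiZD.
Qed.

Lemma chiZ_half m : chi (l%:Z * m) = (-1) ^ m.
Proof.
rewrite chiZ_mulz; suff -> : chi l%:Z = -1 by [].
rewrite /chiZ -pmulrn.
have -> : 2 * pi * l%:R / (2 * l%:R) = pi :> R.
  by field; rewrite nat1r pnatr_eq0.
by rewrite /expi cospi sinpi; apply/eqP; rewrite eq_complex /= oppr0 !eqxx.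
Qed.

Lemma chiZ2_dvd x : (l%:Z %| x)%Z -> chi (2 * x) = 1.
Proof.
case/dvdzP => k ->; have -> : 2 * (k * l%:Z) = k * (2 * l)%N%:Z.
  by rewrite PoszM; ring.
exact: chiZ_period.
Qed.

(** By periodicity x may be replaced by its residue r modulo l. If 0 < r < l,
    the double-angle formula gives Re chi(2r) = 1 - 2 sin^2 t with
    t = pi r / l strictly between 0 and pi, where the sine does not vanish. *)
Lemma chiZ2_eq1 x : (chi (2 * x) == 1) = (l%:Z %| x)%Z.
Proof.
apply/eqP/idP => [|/chiZ2_dvd //].
rewrite [in chi _](divz_eq x l) mulrDr chiZD chiZ2_dvd ?dvdz_mull // mul1r.
move=> chi1; apply/dvdz_mod0P; move: chi1.
have := ltz_pmod x (isT : 0 < l%:Z :> int).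
have := modz_ge0 x (isT : l%:Z != 0 :> int).
case: (x %% l)%Z => // -[|r] // _ r_lt /(congr1 (@complex.Re R)).
have l_gt0 : 0 < l%:R :> R by rewrite ltr0n.
pose t : R := pi * r.+1%:R / l%:R.
have -> : complex.Re (chi (2 * r.+1%:Z)) = 1 - sin t ^+ 2 *+ 2.
  have /= -> : 2 * pi * (2 * r.+1%:Z)%:~R / (2 * l%:R) = t *+ 2 :> R.
    by rewrite /t intrM -pmulrn; field; rewrite nat1r gt_eqF.
  by rewrite cos_mulr2n cos2sin2; ring.
have t_gt0 : 0 < sin t.
  apply: sin_gt0_pi; rewrite divr_gt0 ?mulr_gt0 ?pi_gt0 ?ltr0n //=.
  by rewrite ltr_pdivrMr // ltr_pM2l ?pi_gt0 // ltr_nat.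
move/eqP; rewrite /= subr_eq addrC -subr_eq subrr eq_sym mulrn_eq0 /=.
by rewrite sqrf_eq0 gt_eqF.
Qed.

(** Orthogonality of the characters of the cyclic group of order l, the source
    of the Fourier inversion used below: a geometric sum whose ratio is an
    l-th root of unity. *)
Lemma sum_chiZ2 x :
  \sum_(k < l) chi (2 * x * k%:Z) = if (l%:Z %| x)%Z then l%:R else 0.
Proof.
under eq_bigr => k _ do rewrite chiZ_mulz -exprnP.
case: ifP => lx.
  under eq_bigr => k _ do rewrite chiZ2_dvd // expr1n.
  by rewrite sumr_const card_ord.
apply/eqP; have := expfS_eq1 (chi (2 * x)) n.
rewrite chiZ2_eq1 lx exprnP -chiZ_mulz -mulrA chiZ2_dvd ?dvdz_mull //.
by rewrite eqxx /= => <-.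
Qed.

(** Residue classes modulo l live in the additive group of matrix indices, so
    that cyclic shifts of an index compose by associativity. *)
Definition ordz (m : int) : 'I_l := Zp1 *~ m.

Lemma ordzD m k : ordz (m + k) = ordz m + ordz k.
Proof. exact: mulrzDr. Qed.

Lemma dvdz_ordz m : (l%:Z %| (ordz m)%:Z - m)%Z.
Proof.
have ordz_mul k : ordz (k * l%:Z) = 0.
  rewrite mulrC /ordz mulrzA.
  suff -> : Zp1 *~ l%:Z = 0 :> 'I_l by rewrite mul0rz.
  by rewrite -pmulrn Zp_mulrn; apply: val_inj; rewrite /= modnMl.
rewrite {1}(divz_eq m l) ordzD ordz_mul add0r.
rewrite -(eqz_mod_dvd); apply/eqP; rewrite -[in RHS]modz_mod.
case: (m %% l)%Z (modz_ge0 m (isT : l%:Z != 0 :> int)) => // k _.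
rewrite /ordz -pmulrn Zp_mulrn /= !modz_nat; congr Posz.
by rewrite modn_mod modnMml mul1n.
Qed.

Lemma eq_addr_ordz (i j : 'I_l) m :
  (j == i + ordz m) = (l%:Z %| j%:Z - i%:Z - m)%Z.
Proof.
have -> : j%:Z - i%:Z - m = j%:Z - (i + ordz m)%N%:Z + ((ordz m)%:Z - m).
  by rewrite PoszD; ring.
rewrite (rpredDr _ (dvdz_ordz m)) -eqz_mod_dvd !modz_nat eqz_nat.
by rewrite (modn_small (ltn_ord j)).
Qed.

(** The wrapped index i + m differs from the integer i + m by a multiple of l,
    and chi(2l) = 1. *)
Lemma chiZ2_shift s (i : 'I_l) m :
  chi (s * (2 * (i + ordz m)%R%:Z)) = chi (s * (2 * (i%:Z + m))).
Proof.
move: (eq_addr_ordz i (i + ordz m) m); rewrite eqxx => /esym.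
set j : nat := (i + ordz m)%R => /(dvdz_mull s) /chiZ2_dvd chi1.
have -> : s * (2 * j%:Z) = s * (2 * (i%:Z + m)) + 2 * (s * (j%:Z - i%:Z - m)).
  by ring.
by rewrite chiZD chi1 mulr1.
Qed.

End RootsOfUnity.

(** * The matrices a_{r,m} *)

Section Matrices.
Variables (R : realType) (n : nat).
Local Notation l := (n.+1).
Local Notation chi := (@chiZ R l).

(** The cyclic shift by [m], which is the [m]-th power of [Pmx]. *)
Let shift_mx m : 'M[R[i]]_l := \matrix_(i, j) (j == i + ordz n m)%:R.

Let Pmx_shift : Pmx R n = shift_mx 1.
Proof.
transitivity (\sum_(i < l) delta_mx i (i + ordz n 1) : 'M[R[i]]_l).
  rewrite big_ord_recr /=; congr (_ + _).
    apply: eq_bigr => i _; congr delta_mx; apply: val_inj; rewrite /= inordK.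
    - by [].
    - exact: ltnW (ltn_ord _).
    - rewrite modnDmr modn_small ?addn1 //; exact: ltn_ord.
    - exact: ltn_ord.
  by congr delta_mx; apply: val_inj; rewrite /= modnDmr addn1 modnn.
apply/matrixP => i j; rewrite !mxE summxE (bigD1 i) //= mxE eqxx big1 ?addr0 //.
by move=> k /negPf ki; rewrite mxE eq_sym ki.
Qed.

Let PmxX m : Pmx R n ^ m = shift_mx m.
Proof.
rewrite Pmx_shift; apply: (exprz_morph (g := shift_mx)) => [|{}m k].
  apply/matrixP => i j; rewrite !mxE; congr (_%:R); congr nat_of_bool.
  by rewrite /ordz mulr0z addr0 eq_sym.
apply/matrixP => i j; rewrite !mxE (bigD1 (i + ordz n m)) //= !mxE eqxx mul1r.
rewrite big1 ?addr0 => [|p /negPf pi]; first by rewrite ordzD addrA.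
by rewrite mxE pi mul0r.
Qed.

Let QmxX r : Qmx R n ^ r =
  diag_mx (\row_i chi (r * (2 * (i.+1)%:Z))) :> 'M[R[i]]_l.
Proof.
pose g r : 'M[R[i]]_l := diag_mx (\row_i chi (r * (2 * (i.+1)%:Z))).
have -> : Qmx R n = g 1.
  by congr diag_mx; apply/rowP => i; rewrite !mxE mul1r PoszM.
apply: (exprz_morph (g := g)) => [|m k].
  by apply/matrixP => i j; rewrite !mxE mul0r chiZ0.
rewrite /g -mulmxE mulmx_diag; congr diag_mx.
by apply/rowP => i; rewrite !mxE mulrDl chiZD.
Qed.

(** P^m is a cyclic shift and Q^r is diagonal. Products, periodicity in r and
    Fourier expansions are all read off from these entries. The row index
    appears as [i.+1] because indices start at 0 while Q starts with chi(2). *)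
Lemma amxE r m i j :
  amx R n r m i j = chi (r * (2 * (i.+1)%:Z + m)) * (j == i + ordz n m)%:R.
Proof.
rewrite /amx QmxX PmxX -mulmxE mul_diag_mx !mxE [LHS]mulrA -chiZD.
by congr (chi _ * _); ring.
Qed.

(** This is PQ = chi(2) QP in entries: the phase chi(rm) in the definition of
    a_{r,m} makes the exponent antisymmetric in the two factors. *)
Lemma mul_amx r m s k :
  amx R n r m *m amx R n s k
  = chi (s * m - r * k) *: amx R n (r + s) (m + k).
Proof.
apply/matrixP => i j; rewrite [LHS]mxE [RHS]mxE (bigD1 (i + ordz n m)) //=.
rewrite !amxE eqxx mulr1 ordzD big1 ?addr0 => [|p /negPf pi]; last first.
  by rewrite amxE pi mulr0 mul0r.
rewrite [LHS]mulrA [RHS]mulrA -!chiZD; congr (_ * _).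
- have -> : s * (2 * (i + ordz n m)%R.+1%:Z + k) =
    s * (2 * (i + ordz n m)%R%:Z) + s * (2 + k) by rewrite intS; ring.
  rewrite !chiZD chiZ2_shift -!chiZD; congr chi; rewrite intS; ring.
by rewrite addrA.
Qed.

Lemma bracket_amx r m s k :
  [Lie amx R n r m, amx R n s k]
  = (chi (s * m - r * k) - chi (r * k - s * m)) *: amx R n (r + s) (m + k).
Proof.
rewrite /bracket /= /gl_bracket !mul_amx scalerBl.
by rewrite [s + r]addrC [k + m]addrC.
Qed.

(** Raising [r] by l multiplies the entries by chi(l(2(i + 1) + m)), where
    chi(2l) = 1 and chi(l) = -1. *)
Lemma amx_shift r m : amx R n (r + l%:Z) m = (-1) ^ m *: amx R n r m.
Proof.
apply/matrixP => i j; rewrite [RHS]mxE !amxE [RHS]mulrA; congr (_ * _).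
rewrite -(chiZ_half R n) mulrDl chiZD mulrC mulrDr chiZD; congr (_ * _).
by rewrite mulrCA chiZ2_dvd ?mul1r // dvdz_mulr.
Qed.

End Matrices.

(** * The basis of cells of the loop algebra *)

Section Cells.
Variables (K : fieldType) (n : nat).

Definition cell (i j : 'I_n) (m : int) : loop (gl K n) :=
  loopt (delta_mx i j : gl K n) m.

Lemma looptZ a (X : gl K n) m : loopt (a *: X) m = a *: loopt X m.
Proof. by have := looptP a X 0 m; rewrite loopt0 !addr0. Qed.

Lemma loopt_cells (X : gl K n) m :
  loopt X m = \sum_i \sum_j X i j *: cell i j m.
Proof.
have loopt_sum := big_morph (fun Y : gl K n => loopt Y m)
  (fun Y Z => looptD Y Z m) (loopt0 _ m).
rewrite {1}[X]matrix_sum_delta loopt_sum; apply: eq_bigr => i _.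
by rewrite loopt_sum; apply: eq_bigr => j _; rewrite looptZ.
Qed.

Lemma cell_ind (P : loop (gl K n) -> Prop) :
  P 0 -> (forall a x y, P x -> P y -> P (a *: x + y)) ->
  (forall i j m, P (cell i j m)) -> forall x, P x.
Proof.
move=> P0 PD PC; apply: loop_ind => // X m; rewrite loopt_cells.
have PS x y : P x -> P y -> P (x + y) by move=> /(PD 1 x y); rewrite scale1r.
apply: big_ind => // i _; exact: lin_closed_sum.
Qed.

(** The functions are only assumed to satisfy the linearity equation, so that
    this applies to brackets with one argument held fixed. *)
Lemma cell_linear_eq (W : lmodType K) (f g : loop (gl K n) -> W) :
  linear f -> linear g ->
  (forall i j m, f (cell i j m) = g (cell i j m)) -> f =1 g.
Proof.
move=> f_lin g_lin fg; elim/cell_ind => [|a x y Hx Hy|//].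
  have zero h : linear h -> h (0 : loop (gl K n)) = 0 :> W.
    by move=> hP; have := hP (-1) 0 0; rewrite scaler0 addr0 scaleN1r addNr.
  by rewrite !zero.
by rewrite f_lin g_lin Hx Hy.
Qed.

Lemma bracket_cell (i j p q : 'I_n) a b :
  [Lie cell i j a, cell p q b]
  = (j == p)%:R *: cell i q (a + b) - (q == i)%:R *: cell p j (a + b).
Proof.
rewrite bracket_loopt {1}/bracket /= /gl_bracket !mul_delta_mx_cond.
have cellE (c : bool) (k h : 'I_n) m :
    loopt (delta_mx k h *+ c : gl K n) m = c%:R *: cell k h m.
  by case: c; rewrite ?loopt0 (scale0r, scale1r).
have looptB (Y Z : gl K n) m : loopt (Y - Z) m = loopt Y m - loopt Z m.
  by rewrite -scaleN1r addrC looptP scaleN1r addrC.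
by rewrite looptB !cellE.
Qed.

Section Ext.
Variables (W : lmodType K) (F : 'I_n -> 'I_n -> int -> W).

(** The linear map with prescribed values on the basis of cells. *)
Definition cell_ext : loop (gl K n) -> W :=
  dsum_ext (fun m (X : gl K n) => \sum_i \sum_j X i j *: F i j m).

Let base_lin m a (X Y : gl K n) :
  \sum_i \sum_j (a *: X + Y) i j *: F i j m =
  a *: (\sum_i \sum_j X i j *: F i j m) + \sum_i \sum_j Y i j *: F i j m.
Proof.
rewrite scaler_sumr -big_split; apply: eq_bigr => i _ /=.
rewrite scaler_sumr -big_split; apply: eq_bigr => j _ /=.
by rewrite !mxE scalerDl scalerA.
Qed.

Fact cell_ext_linear : linear cell_ext.
Proof. by move=> a x y; apply: dsum_ext_linear. Qed.

HB.instance Definition _ :=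
  GRing.isLinear.Build K (loop (gl K n)) W *:%R cell_ext cell_ext_linear.

Lemma cell_extE i j m : cell_ext (cell i j m) = F i j m.
Proof.
rewrite /cell_ext /cell /loopt dsum_extU //.
rewrite (bigD1 i) //= (bigD1 j) //= mxE !eqxx scale1r.
rewrite !big1 ?addr0 // => [p /negPf pi|q /negPf qj].
  by rewrite big1 // => q _; rewrite mxE pi scale0r.
by rewrite mxE qj andbF scale0r.
Qed.

End Ext.
End Cells.

(** * Fixed points of the twisted automorphism *)

Section Fixed.
Variables (R : realType) (n : nat).
Local Notation l := (n.+1).
Local Notation chi := (@chiZ R l).
Local Notation fixed := (fixed_pred (@eta1bar R n)).
Local Notation cell := (@cell R[i] l).

(** Cells are eigenvectors: conjugation by Q contributes chi(2(j - i)) and the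
    degree contributes chi(-2m). *)
Lemma eta1bar_cell i j m :
  eta1bar (cell i j m) = chi (2 * (j%:Z - i%:Z - m)) *: cell i j m.
Proof.
pose E : gl R[i] l := delta_mx i j.
have -> : eta1bar (cell i j m) = chi 2 ^ (- m) *: loopt (eta1 E) m.
  exact: loop_twistU.
have -> : eta1 E = chi (2 * (j%:Z - i%:Z)) *: E.
  rewrite /eta1 -mulmxA.
  suff -> : E *m Qmx R n = Qmx R n *m (chi (2 * (j%:Z - i%:Z)) *: E).
    by rewrite mulKmx ?Qmx_unit.
  apply/matrixP => p q; rewrite mul_diag_mx mul_mx_diag !mxE.
  have [->|] := eqVneq p i; last by rewrite !(mulr0, mul0r).
  have [->|] := eqVneq q j; last by rewrite !(mulr0, mul0r).
  rewrite mul1r mulr1 -chiZD; congr chi; rewrite !PoszM !intS; ring.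
rewrite -chiZ_mulz looptZ scalerA -chiZD; congr (chi _ *: _); ring.
Qed.

Lemma cell_fixed i m : cell i (i + ordz n m) m \in fixed.
Proof.
rewrite inE; apply/eqP; rewrite [LHS]eta1bar_cell chiZ2_dvd ?scale1r //.
by rewrite -eq_addr_ordz.
Qed.

(** The fixed points are spanned by the fixed cells. Summing over the l powers
    of the automorphism multiplies a fixed point by l and, by orthogonality,
    kills every cell off the cyclic diagonal j = i + m. *)
Lemma fixed_ind (P : loop (gl R[i] l) -> Prop) :
  P 0 -> (forall a x y, P x -> P y -> P (a *: x + y)) ->
  (forall i m, P (cell i (i + ordz n m) m)) -> forall y, y \in fixed -> P y.
Proof.
move=> P0 PD PC.
have PZ a x : P x -> P (a *: x) by move=> Px; rewrite -[_ *: x]addr0; exact: PD.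
pose f := @eta1bar R n; pose orb y := \sum_(k < l) iter k f y.
have orbP a x y : orb (a *: x + y) = a *: orb x + orb y.
  rewrite scaler_sumr -big_split; apply: eq_bigr => k _ /=.
  by elim: (k : nat) => //= p ->; rewrite /f linearP.
have orb0 : orb 0 = 0.
  by apply: big1 => k _; elim: (k : nat) => //= p ->; rewrite /f linear0.
have orb_cell i j m : orb (cell i j m) =
    (if (l%:Z %| j%:Z - i%:Z - m)%Z then l%:R else 0) *: cell i j m.
  rewrite -(sum_chiZ2 R) scaler_suml; apply: eq_bigr => k _.
  rewrite chiZ_mulz -exprnP; apply: iter_eigen; exact: eta1bar_cell.
have Porb y : P (orb y).
  elim/cell_ind: y => [|a x y Px Py|i j m]; first by rewrite orb0.
    by rewrite orbP; exact: PD.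
  rewrite orb_cell -eq_addr_ordz.
  by case: eqP => [->|_]; [apply: PZ | rewrite scale0r].
move=> y /eqP fy.
suff -> : y = l%:R^-1 *: orb y by exact: PZ.
have -> : orb y = l%:R *: y.
  rewrite /orb (eq_bigr (fun=> y)) => [|k _]; last exact: iter_fix fy.
  by rewrite sumr_const card_ord scaler_nat.
by rewrite scalerA mulVf ?pnatr_eq0 // scale1r.
Qed.

End Fixed.

(** * The homomorphism theta *)

Section Theta.
Variables (R : realType) (n : nat).
Local Notation l := (n.+1).
Local Notation chi := (@chiZ R l).
Local Notation fixed := (fixed_pred (@eta1bar R n)).
Local Notation cell := (@cell R[i] l).

Lemma loopt_amx r m : loopt (amx R n r m) m =
  \sum_(i < l) chi (r * (2 * i.+1%:Z + m)) *: cell i (i + ordz n m) m.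
Proof.
rewrite loopt_cells; apply: eq_bigr => i _.
rewrite (bigD1 (i + ordz n m)) //= amxE eqxx mulr1.
rewrite big1 ?addr0 // => j /negPf ji; by rewrite amxE ji mulr0 scale0r.
Qed.

Lemma loopt_amx_fixed r m : loopt (amx R n r m) m \in fixed.
Proof.
rewrite loopt_amx; apply: rpred_sum => i _; apply: rpredZ; exact: cell_fixed.
Qed.

(** Compatibility with the index set: the exponent r enters the entries only
    through chi(r), which has period 2l. *)
Lemma amx_class r m : amx R n ((r%:~R : 'Z_(2 * l)) : nat) m = amx R n r m.
Proof.
apply/matrixP => i j; rewrite !amxE; congr (_ * _).
by rewrite !(chiZ_mulz R n) -(chiS_class R n r).
Qed.

Lemma Zp_intr (a : 'Z_(2 * l)) : a = (a : nat)%:Z%:~R.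
Proof. by rewrite -pmulrn natr_Zp. Qed.

Definition theta_basis (a : 'Z_(2 * l)) m : fixed_alg (@eta1bar R n) :=
  FixedAlg (loopt_amx_fixed (a : nat) m).

Lemma bracket_theta_basis a m b k :
  [Lie theta_basis a m, theta_basis b k] =
    (chiS R n (b *~ m - a *~ k) - chiS R n (a *~ k - b *~ m))
      *: theta_basis (a + b) (m + k).
Proof.
have dE c p d q : d *~ p - c *~ q
    = ((d : nat)%:Z * p - (c : nat)%:Z * q)%:~R :> 'Z_(2 * l).
  by rewrite intrB !intrM -!Zp_intr !mulrzr.
rewrite !dE !chiS_class; apply: fixed_val_inj.
have E : loopt (amx R n ((a : nat)%:Z + (b : nat)%:Z) (m + k)) (m + k)
    = fixed_val (theta_basis (a + b) (m + k)).
  by rewrite -amx_class intrD -!Zp_intr.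
rewrite fixed_val_bracket bracket_loopt bracket_amx looptZ fixed_valZ.
by rewrite E.
Qed.

Lemma theta_exists :
  exists f : {lie Ahat (chiS R n) -> fixed_alg (@eta1bar R n)},
  f (Ahat_c (chiS R n)) = 0 /\
  forall r m, fixed_val (f (Ahat_Z R n r m)) = loopt (amx R n r m) m.
Proof.
have [|a m b k|f [fc fA _]] :=
    @Ahat_universal _ _ (chiS R n) (fixed_alg (@eta1bar R n)) 0 theta_basis.
- by move=> a m; rewrite bracket0x.
- by rewrite scaler0 addr0 bracket_theta_basis.
exists f; split=> // r m.
by rewrite /Ahat_Z fA /= amx_class.
Qed.

(** The inverse Fourier transform of the cell in row [i] on the cyclic diagonal
    of degree [m]. *)
Definition theta_preimage (i : 'I_l) m : Ahat (chiS R n) :=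
  \sum_(r < l) (l%:R^-1 * chi (- (r%:Z * (2 * i.+1%:Z + m)))) *: Ahat_Z R n r m.

(** Orthogonality over the Fourier index r: the phases involving m cancel. *)
Lemma theta_preimage_coef (i j : 'I_l) m :
  \sum_(r < l) l%:R^-1 * chi (- (r%:Z * (2 * i.+1%:Z + m)))
                * chi (r%:Z * (2 * j.+1%:Z + m)) = (j == i)%:R.
Proof.
transitivity (l%:R^-1 * \sum_(r < l) chi (2 * (j%:Z - i%:Z) * r%:Z)).
  rewrite mulr_sumr; apply: eq_bigr => r _.
  by rewrite -mulrA -chiZD; congr (_ * chi _); rewrite !intS; ring.
rewrite sum_chiZ2 -eqz_mod_dvd !modz_nat !modn_small // eqz_nat.
have -> : (j == i :> nat) = (j == i) by [].
by case: eqP => _; rewrite ?mulr0 // mulVf ?pnatr_eq0.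
Qed.

(** A linear right inverse of theta on the fixed points, extended by 0 to the
    other cells. *)
Definition theta_section : loop (gl R[i] l) -> Ahat (chiS R n) :=
  cell_ext (fun i j m => if j == i + ordz n m then theta_preimage i m else 0).

HB.instance Definition _ := GRing.Linear.on theta_section.

Lemma theta_section_cell i m :
  theta_section (cell i (i + ordz n m) m) = theta_preimage i m.
Proof. by rewrite /theta_section cell_extE eqxx. Qed.

(** Orthogonality over the row index leaves only the r congruent to s modulo
    l; there 2(i + 1)(s - r) contributes nothing to chi and chi((s - r)m)
    remains. *)
Lemma theta_section_amx (s m : int) : theta_section (loopt (amx R n s m) m) =
  \sum_(r < l) (if (l%:Z %| s - r%:Z)%Z then chi ((s - r%:Z) * m) else 0)
    *: Ahat_Z R n r m.
Proof.
rewrite loopt_amx linear_lincomb.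
transitivity (\sum_(i < l) chi (s * (2 * i.+1%:Z + m)) *: theta_preimage i m).
  by apply: eq_bigr => i _; congr (_ *: _); exact: theta_section_cell.
rewrite exchange_lincomb; apply: eq_bigr => r _; congr (_ *: _).
transitivity (l%:R^-1 * chi ((s - r%:Z) * (2 + m))
              * \sum_(i < l) chi (2 * (s - r%:Z) * i%:Z)).
  rewrite mulr_sumr; apply: eq_bigr => i _.
  rewrite mulrCA -!mulrA -!chiZD; congr (_ * chi _).
  by rewrite intS; ring.
rewrite sum_chiZ2; case: ifP => [l_dvd|_]; last by rewrite mulr0.
rewrite mulrAC mulVf ?pnatr_eq0 // mul1r mulrDr chiZD.
by rewrite mulrC [_ * 2]mulrC chiZ2_dvd ?mulr1.
Qed.

Lemma theta_section_amx_nat (s : nat) m :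
  theta_section (loopt (amx R n s m) m) =
  chi ((s%:Z - (s %% l)%N%:Z) * m) *: Ahat_Z R n (s %% l)%N m.
Proof.
pose r0 : 'I_l := Ordinal (ltn_pmod s (ltn0Sn n)).
have dvd_r0 r : (l%:Z %| s%:Z - (r : 'I_l)%:Z)%Z = (r == r0).
  by rewrite -eqz_mod_dvd !modz_nat eqz_nat eq_sym (modn_small (ltn_ord r)).
rewrite theta_section_amx (bigD1 r0) //= [X in _ + X]big1 => [|r /negPf rr0].
  by rewrite addr0 (dvd_r0 r0) eqxx.
by rewrite dvd_r0 rr0 scale0r.
Qed.

Variable theta : {linear Ahat (chiS R n) -> fixed_alg (@eta1bar R n)}.
Hypothesis thetaP : theta_spec theta.

(** The prescribed values determine theta on a basis, so theta is the
    homomorphism given by the presentation of the algebra. *)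
Lemma theta_lie x y : theta [Lie x, y] = [Lie theta x, theta y].
Proof.
have [f [fc fA]] := theta_exists.
suff E : theta =1 f by rewrite !E lie_morphism_subproof.
elim/Ahat_ind => [|a u v Hu Hv|[[a m]|]]; first by rewrite !linear0.
- by rewrite !linearP Hu Hv.
- apply: fixed_val_inj; rewrite /= [a]Zp_intr.
  by rewrite -/(Ahat_Z R n _ m) (thetaP.2) fA.
- by rewrite /= (thetaP.1) fc.
Qed.

Lemma theta_preimageK i m :
  fixed_val (theta (theta_preimage i m)) = cell i (i + ordz n m) m.
Proof.
rewrite linear_lincomb fixed_val_lincomb.
under eq_bigr => r _ do rewrite (thetaP.2) loopt_amx.
rewrite exchange_lincomb (bigD1 i) //= [X in _ + X]big1 => [|j /negPf ji].
  rewrite addr0; set c := (X in X *: _); suff -> : c = 1 by rewrite scale1r.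
  by rewrite /c (theta_preimage_coef i i) eqxx.
set c := (X in X *: _); suff -> : c = 0 by rewrite scale0r.
by rewrite /c (theta_preimage_coef i j) ji.
Qed.

Lemma theta_surj y : exists x, theta x = y.
Proof.
suff [x xy] : exists x, fixed_val (theta x) = fixed_val y.
  by exists x; apply: fixed_val_inj.
have : fixed_val y \in fixed by case: y.
pose P z := exists x, fixed_val (theta x) = z.
rewrite -/(P _); move: (fixed_val y).
apply: (fixed_ind (P := P)) => [|a u v [x <-] [z <-]|i m].
- by exists 0; rewrite linear0.
- by exists (a *: x + z); rewrite linearP.
- by exists (theta_preimage i m); exact: theta_preimageK.
Qed.

Lemma theta_shift u v r m :
  fixed_val (theta u) = loopt (amx R n (r + l%:Z) m) m ->
  fixed_val (theta v) = loopt (amx R n r m) m ->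
  theta (u - (-1) ^ m *: v) = 0.
Proof.
move=> uE vE; rewrite linearB linearZ_LR; apply: fixed_val_inj.
rewrite fixed_val0 fixed_valB fixed_valZ uE vE amx_shift looptZ.
exact: subrr.
Qed.

Let N := ([set Ahat_c (chiS R n)] `|`
  [set v | exists r m : int,
     v = Ahat_Z R n (r + l%:Z) m - (-1) ^ m *: Ahat_Z R n r m])%classic.

(** Classes modulo 2l have representatives s < 2l. If s < l the round trip is
    the identity on A_{s,m}; otherwise s = r + l with r < l, the round trip
    yields chi(lm) A_{r,m} = (-1)^m A_{r,m}, and the difference is one of the
    generators of the span. *)
Lemma theta_section_theta x :
  lin_span N (x - theta_section (fixed_val (theta x))).
Proof.
elim/Ahat_ind: x => [|a x y Hx Hy|[[a m]|]].
- rewrite [theta 0]linear0 fixed_val0 [theta_section 0]linear0.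
  by rewrite subr0; exact: lin_span0.
- pose f x := theta_section (fixed_val (theta x)).
  have fP : f (a *: x + y) = a *: f x + f y.
    by rewrite /f linearP fixed_valP linearP.
  exact: (lin_span_subP fP Hx Hy).
- rewrite /Ahat_basis [a]Zp_intr -/(Ahat_Z R n _ m) (thetaP.2).
  rewrite theta_section_amx_nat.
  have : (a < l + l)%N.
    have l2_gt1 : (1 < 2 * l)%N by rewrite mulnS.
    by rewrite addnn -mul2n -[X in (_ < X)%N](Zp_cast l2_gt1) ltn_ord.
  move: (nat_of_ord a) => s.
  case: (ltnP s l) => [s_lt _|/subnK <-].
    rewrite modn_small // subrr mul0r chiZ0 scale1r subrr; exact: lin_span0.
  move: (s - l)%N => r; rewrite ltn_add2r => r_lt.
  rewrite modnDr modn_small // PoszD [r%:Z + _ - _]addrAC subrr add0r chiZ_half.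
  by apply: lin_span_gen; right; exists r%:Z, m.
- rewrite (thetaP.1) linear0 subr0; by apply: lin_span_gen; left.
Qed.

Lemma theta_ker : [set x | theta x = 0]%classic = lin_span N.
Proof.
apply/seteqP; split=> [x /= x0|x].
  by have := theta_section_theta x; rewrite x0 linear0 subr0.
apply: lin_span_ker => y [->|[r [m ->]]]; first exact: thetaP.1.
exact: theta_shift (thetaP.2 _ _) (thetaP.2 _ _).
Qed.

End Theta.

(** * Untwisting the fixed points *)

Section Unwind.
Variables (R : realType) (n : nat).
Local Notation l := (n.+1).
Local Notation fixed := (fixed_pred (@eta1bar R n)).
Local Notation cell := (@cell R[i] l).

(** The map X(t) |-> D^(-1) X(t^l) D, where D is diagonal with entries t^j. *)
Definition wind : loop (gl R[i] l) -> loop (gl R[i] l) :=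
  cell_ext (fun i j k => cell i j (k * l%:Z + (j%:Z - i%:Z))).

HB.instance Definition _ := GRing.Linear.on wind.

(** The inverse of [wind] on the fixed points, where m - (j - i) is a multiple
    of l and the division is exact. *)
Definition unwind : loop (gl R[i] l) -> loop (gl R[i] l) :=
  cell_ext (fun i j m => cell i j ((m - (j%:Z - i%:Z)) %/ l%:Z)%Z).

HB.instance Definition _ := GRing.Linear.on unwind.

Lemma wind_cell i j k :
  wind (cell i j k) = cell i j (k * l%:Z + (j%:Z - i%:Z)).
Proof. exact: cell_extE. Qed.

Lemma unwind_cell i j m :
  unwind (cell i j m) = cell i j ((m - (j%:Z - i%:Z)) %/ l%:Z)%Z.
Proof. exact: cell_extE. Qed.

Lemma windP a x y : wind (a *: x + y) = a *: wind x + wind y.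
Proof. exact: linearP. Qed.

Lemma unwindP a x y : unwind (a *: x + y) = a *: unwind x + unwind y.
Proof. exact: linearP. Qed.

Lemma windK : cancel wind unwind.
Proof.
apply: (cell_linear_eq (g := id)) => [a x y|//|i j k].
  by rewrite windP unwindP.
by rewrite wind_cell unwind_cell addrK mulzK.
Qed.

Lemma unwindK y : y \in fixed -> wind (unwind y) = y.
Proof.
pose P z := wind (unwind z) = z.
move: y; apply: (fixed_ind (P := P)) => [|a u v Hu Hv|i m]; rewrite /P.
- by rewrite [unwind 0]linear0 [LHS]linear0.
- by rewrite unwindP windP; exact: (congr2 (fun x y => a *: x + y) Hu Hv).
rewrite unwind_cell wind_cell divzK ?subrK //.
by rewrite -rpredN opprB -eq_addr_ordz.
Qed.

Lemma wind_fixed x : wind x \in fixed.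
Proof.
elim/cell_ind: x => [|a x y Hx Hy|i j k].
- by rewrite [wind 0]linear0 rpred0.
- by rewrite windP; apply: rpredD; [apply: rpredZ; exact: Hx | exact: Hy].
rewrite wind_cell; set m := _ + _.
suff /eqP {1}-> : j == i + ordz n m by exact: cell_fixed.
by rewrite eq_addr_ordz /m addrC opprD subrK rpredN dvdz_mull.
Qed.

(** In a product E_ij E_jq the shifts of the exponent of t add up:
    (j - i) + (q - j) = q - i. *)
Lemma wind_lie x y : wind [Lie x, y] = [Lie wind x, wind y].
Proof.
move: x; apply: cell_linear_eq => [a u v|a u v|i j k].
- by rewrite bracketPl windP.
- by rewrite windP bracketPl.
move: y; apply: cell_linear_eq => [a u v|a u v|p q h].
- by rewrite bracketPr windP.
- by rewrite windP bracketPr.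
rewrite !wind_cell !bracket_cell.
pose e := k * l%:Z + (j%:Z - i%:Z) + (h * l%:Z + (q%:Z - p%:Z)).
have iq : j == p -> wind (cell i q (k + h)) = cell i q e.
  by move=> /eqP jp; rewrite wind_cell /e jp; congr cell; ring.
have pj : q == i -> wind (cell p j (k + h)) = cell p j e.
  by move=> /eqP qi; rewrite wind_cell /e qi; congr cell; ring.
exact: linear_boolB iq pj.
Qed.

Lemma fixed_alg_isomorphic :
  exists phi : {lie fixed_alg (@eta1bar R n) -> loop (gl R[i] l)},
    bijective phi.
Proof.
pose phi (y : fixed_alg (@eta1bar R n)) := unwind (fixed_val y).
pose psi x : fixed_alg (@eta1bar R n) := FixedAlg (wind_fixed x).
have phiK : cancel phi psi.
  by move=> y; apply: fixed_val_inj; apply: unwindK; case: y.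
have psiK : cancel psi phi by move=> x; rewrite /phi; exact: (windK x).
have phi_lin : linear phi.
  by move=> a x y; rewrite /phi fixed_valP linearP.
have phi_lie x y : phi [Lie x, y] = [Lie phi x, phi y].
  apply: (can_inj psiK); rewrite phiK; apply: fixed_val_inj.
  have wind_phi z : wind (phi z) = fixed_val z by apply: unwindK; case: z.
  rewrite fixed_val_bracket; apply: etrans (esym (wind_lie _ _)).
  exact: (esym (congr2 bracket (wind_phi x) (wind_phi y))).
pose phiL := GRing.isLinear.Build R[i] _ _ *:%R phi phi_lin.
pose phiF := isLieMorphism.Build R[i] _ _ phi phi_lie.
pose f : {lie fixed_alg (@eta1bar R n) -> loop (gl R[i] l)} :=
  HB.pack phi phiL phiF.
exists f; exists psi; [exact: phiK | exact: psiK].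
Qed.

End Unwind.

Theorem theorem5p8 (R : realType) (n : nat) :
  [/\ exists theta : {linear Ahat (chiS R n) -> fixed_alg (@eta1bar R n)},
         theta_spec theta,
      forall theta : {linear Ahat (chiS R n) -> fixed_alg (@eta1bar R n)},
        theta_spec theta ->
        [/\ forall x y : Ahat (chiS R n),
               theta [Lie x, y] = [Lie theta x, theta y],
            forall y : fixed_alg (@eta1bar R n), exists x, theta x = y
          & [set x | theta x = 0]%classic =
            lin_span ([set Ahat_c (chiS R n)] `|`
              [set v | exists r m : int,
                 v = Ahat_Z R n (r + n.+1%:Z) m
                     - (-1) ^ m *: Ahat_Z R n r m])%classic]
    & exists phi : {lie fixed_alg (@eta1bar R n) -> loop (gl R[i] n.+1)},
        bijective phi].
Proof.
split; last exact: fixed_alg_isomorphic.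
  by have [f fP] := theta_exists R n; exists f.
move=> theta thetaP; split.
- exact: theta_lie thetaP.
- exact: theta_surj thetaP.
- exact: theta_ker thetaP.
Qed.
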